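(* Let $G$ be a simple connected graph with $n$ nodes and $m$ edges, let $q$ be a positive integer, and let $R_q(G)$ be its $q$-triangulation graph. Then the Kirchhoff index satisfies $$\mathcal K(R_q(G))=\frac{2}{q+2}\mathcal K(G)+\frac{q}{q+2}\bar{\mathcal K}(G)+\frac{q^2}{2(q+2)}\hat{\mathcal K}(G)+\frac{m^2q^2}{2}+\frac{(2m-n)(n-1)q}{2(q+2)}.$$
   Context: For a positive integer $q$, the $q$-triangulation graph $R_q(G)$ is obtained from $G$ by keeping all nodes and edges of $G$ and adding, for each edge $uv$ of $G$, $q$ disjoint paths of length $2$: $ux_1v,\dots,ux_qv$, where $x_1,\dots,x_q$ are new nodes. The resistance distance $r_{ij}$ between nodes $i,j$ of a simple connected graph is the effective resistance between them when every edge is replaced by a unit resistor. With $d_i$ the degree of node $i$ and sums over unordered pairs of distinct nodes: the Kirchhoff index is $\mathcal K(G)=\sum_{\{i,j\}\subseteq V(G)}r_{ij}$, the additive degree-Kirchhoff index is $\bar{\mathcal K}(G)=\sum_{\{i,j\}\subseteq V(G)}(d_i+d_j)r_{ij}$, and the multiplicative degree-Kirchhoff index is $\hat{\mathcal K}(G)=\sum_{\{i,j\}\subseteq V(G)}d_id_jr_{ij}$. *)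

(* Defs.v *)
From HB Require Import structures.
From mathcomp Require Import all_boot all_order all_algebra.
From mathcomp Require Import boolp classical_sets.

Set Implicit Arguments.
Unset Strict Implicit.
Unset Printing Implicit Defensive.

Import Order.TTheory GRing.Theory Num.Theory.
Local Open Scope ring_scope.

Record sgraph := SGraph {
  svertex :> finType;
  sedge : rel svertex;
  sedge_sym : symmetric sedge;
  sedge_irrefl : irreflexive sedge
}.

Definition connected (G : sgraph) : Prop :=
  (0 < #|G|)%N /\ forall x y : G, connect (@sedge G) x y.

Definition deg (G : sgraph) (x : G) : nat := #|[set y | sedge x y]|.

Definition edges (G : sgraph) : {set {set G}} :=
  [set A | [exists x, exists y, sedge x y && (A == [set x; y])]].

Section Triangulation.
Variables (q : nat) (G : sgraph).

(* [inr (A, k)] is the middle node x_k of the k-th path of length 2 added for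
   the edge A. *)
Definition tri_vertex : finType :=
  (G + {A : {set G} | A \in edges G} * 'I_q)%type.

Definition tri_edge (a b : tri_vertex) : bool :=
  match a, b with
  | inl x, inl y => sedge x y
  | inl x, inr (A, _) => x \in val A
  | inr (A, _), inl x => x \in val A
  | inr _, inr _ => false
  end.

Lemma tri_edge_sym : symmetric tri_edge.
Proof. by case=> [x|[A k]] [y|[B l]] //=; apply: sedge_sym. Qed.

Lemma tri_edge_irrefl : irreflexive tri_edge.
Proof. by case=> [x|[A k]] //=; apply: sedge_irrefl. Qed.

Definition triangulation : sgraph := SGraph tri_edge_sym tri_edge_irrefl.

End Triangulation.

Section Resistance.
Variables (R : realFieldType) (G : sgraph).

(* Kirchhoff's current law when every edge is a unit resistor and a unit
   current enters the network at i and leaves it at j: by Ohm's law the current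
   through the edge xy, from x to y, is v x - v y. *)
Definition unit_current_potential (i j : G) (v : G -> R) : Prop :=
  forall x, \sum_(y | sedge x y) (v x - v y) = (x == i)%:R - (x == j)%:R.

(* The voltage between i and j does not depend on the chosen potential (see
   [voltage_unique]), and a potential exists when i and j are connected; the
   default value 0 is used only if there is none. *)
Definition resistance (i j : G) : R :=
  xget 0 [set r | exists2 v, unit_current_potential i j v & r = v i - v j]%classic.

Lemma unit_current_pairing (i j : G) (v w : G -> R) :
  unit_current_potential i j v ->
  \sum_x w x * \sum_(y | sedge x y) (v x - v y) = w i - w j.
Proof.
move=> vP; under eq_bigr => x _ do rewrite vP mulrBr.
rewrite sumrB; congr (_ - _).
  rewrite (bigD1 i) //= eqxx mulr1 big1 ?addr0 // => x /negPf ->.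
  by rewrite mulr0.
rewrite (bigD1 j) //= eqxx mulr1 big1 ?addr0 // => x /negPf ->.
by rewrite mulr0.
Qed.

Lemma laplacian_sym (v w : G -> R) :
  \sum_x w x * \sum_(y | sedge x y) (v x - v y) =
  \sum_x v x * \sum_(y | sedge x y) (w x - w y).
Proof.
have expand (f g : G -> R) : \sum_x f x * \sum_(y | sedge x y) (g x - g y) =
    \sum_x \sum_(y | sedge x y) f x * g x - \sum_x \sum_(y | sedge x y) f x * g y.
  rewrite -sumrB; apply: eq_bigr => x _.
  by rewrite mulr_sumr -sumrB; apply: eq_bigr => y _; rewrite mulrBr.
rewrite !expand; congr (_ - _).
  by do 2![apply: eq_bigr => ? _]; rewrite mulrC.
rewrite (exchange_big_dep xpredT) //=; apply: eq_bigr => x _.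
by apply: eq_big => y; [rewrite sedge_sym | rewrite mulrC].
Qed.

Lemma voltage_unique (i j : G) (v w : G -> R) :
  unit_current_potential i j v -> unit_current_potential i j w ->
  v i - v j = w i - w j.
Proof.
move=> vP wP.
by rewrite -(unit_current_pairing v wP) laplacian_sym (unit_current_pairing w vP).
Qed.

(* Every unordered pair {i, j} of distinct nodes is listed once, with its nodes
   in the order of the enumeration of G; used for symmetric f only. *)
Definition sum_pairs (f : G -> G -> R) : R :=
  \sum_(i : G) \sum_(j : G | (enum_rank i < enum_rank j)%N) f i j.

Definition kirchhoff : R := sum_pairs resistance.

Definition add_deg_kirchhoff : R :=
  sum_pairs (fun i j => ((deg i)%:R + (deg j)%:R) * resistance i j).

Definition mul_deg_kirchhoff : R :=
  sum_pairs (fun i j => (deg i)%:R * (deg j)%:R * resistance i j).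

End Resistance.

(* Main.v *)
Require Import Defs.
From mathcomp Require Import all_boot all_order all_algebra.
From mathcomp Require Import boolp classical_sets.
From mathcomp Require Import ring.
Import GRing.Theory Num.Theory.
Local Open Scope ring_scope.

(** Write [H] for the [q]-triangulation of [G] and [r] for the resistance
    distance of [G].  To every node [a] of [H] attach a probability measure
    [foot a] on the nodes of [G]: the point mass at [a] if [a] is an old node,
    and half a unit at each end of [uv] if [a] is a middle node of [uv].  A
    unit current injected at [a] can be moved to [foot a] at a known cost, after
    which a network problem on [H] becomes one on [G]:

    - extend a potential [w] of [G] to [H] by giving each middle node the mean
      of its two ends.  No current enters at the middle nodes, and since each
      edge is now in parallel with [q] resistors of size 2, the currents at the
      old nodes are multiplied by [1 + q / 2] ([laplacian_extend]);
    - the potential with value 1/2 at a middle node [a] and 0 elsewhere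
      transports a unit of current from [a] to [foot a] ([laplacian_lead]).

    Hence, for [a != b], with [c := foot a - foot b], a charge of total 0,

      r_H(a, b) = lead a + lead b + 2 / (q + 2) * energy of c in G,

    where [lead] is 1/2 on middle nodes and 0 on old nodes, and the energy of a
    neutral charge is [- (\sum_i \sum_j c i * c j * r i j) / 2] ([green_energy]).
    This is [triangulation_resistance].

    Now sum over all ordered pairs [a, b] ([sum_sqr_diff]).  The cross terms
    involve [foot] only through its sum over [a], which at [x] is
    [1 + q / 2 * deg x]; they produce the three Kirchhoff indices of [G].  In
    the diagonal terms, [r] is averaged over two independent points of law
    [foot a], which gives half the resistance of the edge under a middle node,
    and 0 at an old node; their total is given by Foster's theorem: the
    resistances of the edges of [G] add up to [n - 1] ([foster]).

    Everything about [r] comes from a Green function [g] of the Laplacian of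
    [G], which exists because a function of zero Dirichlet energy on a
    connected graph is constant ([green_exists]). *)

(** * Laplacians and Green functions *)

Lemma sum_enum_val (V : nmodType) (T : finType) (f : T -> V) :
  \sum_x f x = \sum_(i < #|T|) f (enum_val i).
Proof. by rewrite -big_enum_val. Qed.

(** An injective endomorphism of the finite-dimensional space of functions on
    [T] is surjective; stated for kernels, so that no enumeration of [T] shows
    in its uses. *)
Lemma inverse_kernel_of_injective (F : fieldType) (T : finType)
    (K : T -> T -> F) :
  (forall f : T -> F, (forall y, \sum_x f x * K x y = 0) -> forall x, f x = 0) ->
  exists g : T -> T -> F, forall x y, \sum_z g x z * K z y = (x == y)%:R.
Proof.
move=> Kinj.
pose M := \matrix_(i < #|T|, j < #|T|) K (enum_val i) (enum_val j).
have Munit : M \in unitmx.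
  rewrite -row_free_unit -kermx_eq0; apply/rowV0P => u /sub_kermxP uM0.
  have u0 x : u 0 (enum_rank x) = 0.
    apply: (Kinj (fun x => u 0 (enum_rank x))) => y.
    have := congr1 (fun r : 'rV_#|T| => r 0 (enum_rank y)) uM0.
    rewrite !mxE => uMy; rewrite -[RHS]uMy sum_enum_val.
    by apply: eq_bigr => i _; rewrite !mxE enum_valK enum_rankK.
  by apply/rowP => i; rewrite mxE -[i]enum_valK u0.
exists (fun x y => invmx M (enum_rank x) (enum_rank y)) => x y.
have := congr1 (fun A : 'M_#|T| => A (enum_rank x) (enum_rank y)) (mulVmx Munit).
rewrite !mxE (inj_eq enum_rank_inj) => <-.
rewrite sum_enum_val.
by apply: eq_bigr => i _; rewrite !mxE enum_valK enum_rankK.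
Qed.

Definition laplacian {R : realFieldType} {G : sgraph} (v : G -> R) (x : G) : R :=
  \sum_(y | sedge x y) (v x - v y).

Lemma degE (R : realFieldType) (G : sgraph) (x : G) :
  (deg x)%:R = \sum_(y | sedge x y) 1 :> R.
Proof. by rewrite sumr_const /deg cardsE. Qed.

Lemma laplacian_delta (R : realFieldType) (G : sgraph) (a x : G) (c : R) :
  laplacian (fun y => (y == a)%:R * c) x =
  c * ((x == a)%:R * (deg a)%:R - (sedge x a)%:R).
Proof.
rewrite /laplacian sumrB mulrBr; congr (_ - _).
  case: eqP => [->|_]; last by rewrite !mul0r mulr0 big1.
  rewrite !mul1r degE mulr_sumr; apply: eq_bigr => y _.
  by rewrite mulr1.
rewrite -mulr_suml mulrC; congr (_ * _); case xa: (sedge x a).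
  by rewrite (bigD1 a) //= eqxx big1 ?addr0 // => y /andP[_ /negPf->].
by apply: big1 => y xy; case: eqP xy => // ->; rewrite xa.
Qed.

(** Discrete integration by parts: every edge is met in both directions, and
    the two contributions combine into the square. *)
Lemma laplacian_energy (R : realFieldType) (G : sgraph) (v : G -> R) :
  \sum_x \sum_(y | sedge x y) (v x - v y) ^+ 2 =
  2 * \sum_x v x * laplacian v x.
Proof.
have swap : \sum_x \sum_(y | sedge x y) v y * (v y - v x) =
            \sum_x \sum_(y | sedge x y) v x * (v x - v y).
  rewrite (exchange_big_dep xpredT) //=; apply: eq_bigr => x _.
  by apply: eq_bigl => y; rewrite sedge_sym.
under [in RHS]eq_bigr do rewrite mulr_sumr.
rewrite mulr_natl mulr2n -[X in _ = X + _]swap -big_split /=.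
apply: eq_bigr => x _; rewrite -big_split /=.
by apply: eq_bigr => y _; ring.
Qed.

Lemma sum_laplacian (R : realFieldType) (G : sgraph) (v : G -> R) :
  \sum_x laplacian v x = 0.
Proof.
have /= := laplacian_sym v (fun=> 1).
under eq_bigr do rewrite mul1r.
move=> ->; apply: big1 => x _.
by rewrite big1 ?mulr0 // => y _; rewrite subrr.
Qed.

Lemma energy0_const {R : realFieldType} {G : sgraph} (v : G -> R) :
  connected G -> \sum_x v x * laplacian v x = 0 -> forall x y, v x = v y.
Proof.
move=> [_ Gconn] v0.
have := laplacian_energy _ _ v; rewrite v0 mulr0 => sum0.
have edge_eq x y : sedge x y -> v x = v y.
  move=> xy.
  have inner_ge0 z : 0 <= \sum_(y | sedge z y) (v z - v y) ^+ 2.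
    by apply: sumr_ge0 => *; apply: sqr_ge0.
  have /(_ x isT)/psumr_eq0P sumx0 := psumr_eq0P (fun z _ => inner_ge0 z) sum0.
  have /eqP := sumx0 (fun z _ => sqr_ge0 _) y xy.
  by rewrite sqrf_eq0 subr_eq0 => /eqP.
move=> x y; have /connectP[p] := Gconn x y.
elim: p x => [|z p IHp] x /= => [_ -> //|/andP[/edge_eq-> zp] ylast].
exact: IHp.
Qed.

(** The Laplacian kills the constants; adding the total of the function makes
    it injective.  The modified operator multiplies constants by [#|G|], hence
    so does its inverse by [1 / #|G|], and each row of [g] has this total. *)
Lemma green_exists (R : realFieldType) (G : sgraph) :
  connected G -> exists g : G -> G -> R,
    forall i x, laplacian (g i) x = (i == x)%:R - (#|G|%:R)^-1.
Proof.
move=> Gconn; have card_neq0 : #|G|%:R != 0 :> R.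
  by rewrite pnatr_eq0 -lt0n; case: Gconn.
(* The kernel of the operator mapping f to its Laplacian plus its total. *)
pose K (x y : G) : R := (x == y)%:R * (deg x)%:R - (sedge y x)%:R + 1.
have KE (f : G -> R) y : \sum_x f x * K x y = laplacian f y + \sum_x f x.
  rewrite /K; under eq_bigr do rewrite mulrDr mulr1 mulrBr.
  rewrite big_split sumrB /=; congr (_ + _).
  rewrite /laplacian sumrB; congr (_ - _).
    rewrite (bigD1 y) //= eqxx mul1r big1 ?addr0 => [|x /negPf->].
      by rewrite sumr_const /deg cardsE mulr_natr.
    by rewrite mul0r mulr0.
  by rewrite [RHS]big_mkcond; apply: eq_bigr => x _; case: sedge; rewrite ?mulr1 ?mulr0.
have [f f0|g gK] := @inverse_kernel_of_injective R G K.
  have lap_f y : laplacian f y = - \sum_x f x.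
    by apply/eqP; rewrite -addr_eq0 -KE f0.
  have sum_f : \sum_x f x = 0.
    have := sum_laplacian _ _ f; under eq_bigr do rewrite lap_f.
    rewrite sumr_const -mulr_natr => /eqP.
    by rewrite mulf_eq0 (negPf card_neq0) orbF oppr_eq0 => /eqP.
  have f_const x y : f x = f y.
    apply: (energy0_const _ Gconn); apply: big1 => z _.
    by rewrite lap_f sum_f oppr0 mulr0.
  move=> x; move: sum_f; under eq_bigr do rewrite (f_const _ x).
  rewrite sumr_const -mulr_natr => /eqP.
  by rewrite mulf_eq0 (negPf card_neq0) orbF => /eqP.
exists g => i x; rewrite -gK KE.
suff -> : \sum_z g i z = (#|G|%:R)^-1 by rewrite addrK.
apply: (mulIf card_neq0); rewrite mulVf //.
have : \sum_y \sum_z g i z * K z y = 1.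
  under eq_bigr do rewrite gK.
  by rewrite (bigD1 i) //= eqxx big1 ?addr0 // => y; rewrite eq_sym => /negPf->.
under eq_bigr do rewrite KE.
by rewrite big_split /= sum_laplacian add0r sumr_const mulr_natr.
Qed.

(** * Resistance, energy and the theorem of Foster *)

Lemma resistanceE (R : realFieldType) (G : sgraph) (i j : G) (v : G -> R) :
  unit_current_potential i j v -> resistance R i j = v i - v j.
Proof.
move=> vP; apply: xget_unique; first by exists v.
by move=> _ [w wP ->]; apply: voltage_unique wP vP.
Qed.

Lemma resistancexx (R : realFieldType) (G : sgraph) (x : G) :
  resistance R x x = 0.
Proof.
rewrite (resistanceE _ _ _ _ (fun=> 0)) ?subrr // => y.
by rewrite big1 ?subrr // => z _; rewrite subrr.
Qed.

(** Negating a potential reverses the current. *)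
Lemma resistanceC (R : realFieldType) (G : sgraph) (x y : G) :
  resistance R x y = resistance R y x.
Proof.
have opp (i j : G) (v : G -> R) :
    unit_current_potential i j v -> unit_current_potential j i (\- v).
  move=> vP z; rewrite -opprB -vP -sumrN.
  by apply: eq_bigr => w _ /=; ring.
congr (xget 0 _); apply/seteqP; split=> _ [v /opp vP ->];
  by exists (\- v) => //=; ring.
Qed.

Section Green.
Context {R : realFieldType} {G : sgraph} (g : G -> G -> R).
Hypothesis gE : forall i x, laplacian (g i) x = (i == x)%:R - (#|G|%:R)^-1.

Lemma laplacian_green_sum (c : G -> R) x :
  \sum_i c i = 0 -> laplacian (fun y => \sum_i c i * g i y) x = c x.
Proof.
move=> c0.
transitivity (\sum_i c i * laplacian (g i) x).
  rewrite /laplacian; under [RHS]eq_bigr do rewrite mulr_sumr.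
  rewrite [RHS]exchange_big /=; apply: eq_bigr => y _.
  by rewrite -sumrB; apply: eq_bigr => i _; rewrite mulrBr.
under eq_bigr do rewrite gE mulrBr.
rewrite sumrB -mulr_suml c0 mul0r subr0 (bigD1 x) //= eqxx mulr1.
by rewrite big1 ?addr0 // => i /negPf->; rewrite mulr0.
Qed.

Lemma resistance_green (i j : G) :
  resistance R i j = g i i + g j j - g i j - g j i.
Proof.
rewrite (resistanceE _ _ _ _ (fun x => g i x - g j x)); first by ring.
move=> x; transitivity (laplacian (g i) x - laplacian (g j) x).
  by rewrite /laplacian -sumrB; apply: eq_bigr => y _; ring.
by rewrite !gE (eq_sym i) (eq_sym j); ring.
Qed.

(** In [r i j = g i i + g j j - g i j - g j i] the terms depending on one
    index only disappear against a neutral charge. *)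
Lemma green_energy (c : G -> R) : \sum_i c i = 0 ->
  \sum_x c x * (\sum_i c i * g i x) =
  - (\sum_i \sum_j c i * c j * resistance R i j) / 2.
Proof.
move=> c0.
have self (f : G -> R) : \sum_i \sum_j c i * c j * f i = 0.
  apply: big1 => i _; under eq_bigr do rewrite mulrAC.
  by rewrite -mulr_sumr c0 mulr0.
have self' (f : G -> R) : \sum_i \sum_j c i * c j * f j = 0.
  rewrite exchange_big /= -[RHS](self f); apply: eq_bigr => i _.
  by apply: eq_bigr => j _; ring.
have cross : \sum_i \sum_j c i * c j * g j i = \sum_i \sum_j c i * c j * g i j.
  rewrite exchange_big; apply: eq_bigr => i _.
  by apply: eq_bigr => j _ /=; ring.
have -> : \sum_x c x * (\sum_i c i * g i x) = \sum_i \sum_j c i * c j * g i j.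
  rewrite -cross; apply: eq_bigr => x _.
  by rewrite mulr_sumr; apply: eq_bigr => i _; rewrite mulrA.
have -> : \sum_i \sum_j c i * c j * resistance R i j =
   - (2 * \sum_i \sum_j c i * c j * g i j).
  transitivity (\sum_i \sum_j c i * c j * g i i + \sum_i \sum_j c i * c j * g j j
    - \sum_i \sum_j c i * c j * g i j - \sum_i \sum_j c i * c j * g j i).
    rewrite -big_split -!sumrB; apply: eq_bigr => i _ /=.
    rewrite -big_split -!sumrB; apply: eq_bigr => j _ /=.
    by rewrite resistance_green; ring.
  by rewrite self (self' (fun j => g j j)) cross; ring.
by field.
Qed.

(** Summed over oriented edges, [r x y] contributes twice the trace of the
    operator [laplacian \o g], which is the projection along the constants. *)
Lemma foster : (0 < #|G|)%N ->
  \sum_(x : G) \sum_(y | sedge x y) resistance R x y = 2 * (#|G|%:R - 1).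
Proof.
move=> G_gt0; have card_neq0 : #|G|%:R != 0 :> R by rewrite pnatr_eq0 -lt0n.
have trace : \sum_x laplacian (g x) x = #|G|%:R - 1.
  under eq_bigr do rewrite gE eqxx.
  by rewrite sumrB !sumr_const -[X in _ - X]mulr_natr mulVf.
have swap : \sum_x \sum_(y | sedge x y) (g y y - g y x) =
            \sum_x laplacian (g x) x.
  rewrite (exchange_big_dep xpredT) //=; apply: eq_bigr => x _.
  by apply: eq_bigl => y; rewrite sedge_sym.
rewrite -trace mulr_natl mulr2n -[X in _ = X + _]swap -big_split /=.
apply: eq_bigr => x _; rewrite /laplacian -big_split /=.
by apply: eq_bigr => y _; rewrite resistance_green; ring.
Qed.

End Green.

(** * Sums over the edges of a graph *)

Lemma sum_edges_at (R : realFieldType) (G : sgraph) (x : G) (F : {set G} -> R) :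
  \sum_(A in edges G | x \in A) F A = \sum_(y | sedge x y) F [set x; y].
Proof.
have inj : {in [set y | sedge x y] &, injective (fun y => [set x; y])}.
  move=> y z; rewrite !inE => xy _ /setP/(_ y).
  rewrite !inE eqxx orbT; case: eqP => [yx|_ /esym/eqP //].
  by rewrite yx sedge_irrefl in xy.
transitivity (\sum_(y in [set y | sedge x y]) F [set x; y]); last first.
  by apply: eq_bigl => y; rewrite inE.
rewrite -(big_imset F inj); apply: eq_bigl => A.
apply/andP/imsetP => [[]|[y]]; rewrite inE.
  case/existsP=> u /existsP[v /andP[uv /eqP->]].
  rewrite !inE => /orP[]/eqP->; first by exists v; rewrite // inE.
  by exists u; [rewrite inE sedge_sym | exact: finset.setUC].
move=> xy ->; split; last by rewrite !inE eqxx.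
by rewrite inE; apply/existsP; exists x; apply/existsP; exists y; rewrite xy eqxx.
Qed.

Lemma sum_edge (R : realFieldType) (G : sgraph) (x y : G) (F : G -> R) :
  sedge x y -> \sum_(z in [set x; y]) F z = F x + F y.
Proof.
move=> xy; rewrite big_setU1 ?big_set1 // inE.
by apply: contraTneq xy => ->; rewrite sedge_irrefl.
Qed.

Lemma sum_edge_ends (R : realFieldType) (G : sgraph) (F : G -> G -> R) :
  \sum_(A in edges G) \sum_(x in A) \sum_(y in A) F x y =
  \sum_x \sum_(y | sedge x y) (F x x + F x y).
Proof.
rewrite (exchange_big_dep xpredT) //=; apply: eq_bigr => x _.
rewrite (sum_edges_at _ _ x (fun A => \sum_(y in A) F x y)).
by apply: eq_bigr => y xy; rewrite sum_edge.
Qed.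

(** * Potentials on the triangulation *)

Section Triangulation.
Context {R : realFieldType} {q : nat} {G : sgraph}.
Notation H := (triangulation q G).

(** The charge on the old nodes equivalent to a unit charge at [z]; it is also
    the row at [z] of the extension operator [extend]. *)
Definition foot (z : H) (x : G) : R :=
  match z with
  | inl y => (x == y)%:R
  | inr (A, _) => (x \in val A)%:R / 2
  end.

(** The effective resistance between [z] and its old neighbours merged into
    one, which for a middle node is that of two unit resistors in parallel. *)
Definition lead (z : H) : R := if z is inr _ then 1 / 2 else 0.

Definition old_charge (c : G -> R) (z : H) : R := if z is inl x then c x else 0.

(** The middle nodes over an edge are interchangeable: a summand that sees
    only the edge is counted [q] times. *)
Lemma sum_triangulation (P : pred H) (F : H -> R) (Pe : pred {set G})
    (Fe : {set G} -> R) :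
  (forall A k, P (inr (A, k)) = Pe (val A)) ->
  (forall A k, F (inr (A, k)) = Fe (val A)) ->
  \sum_(z | P z) F z =
  \sum_(x | P (inl x)) F (inl x) + q%:R * \sum_(A in edges G | Pe A) Fe A.
Proof.
move=> PE FE; rewrite big_sumType /=; congr (_ + _).
rewrite big_sub_cond mulr_sumr.
rewrite (eq_big (fun p => Pe (val p.1) && true) (fun p => Fe (val p.1))); first last.
- by case=> A k _; apply: FE.
- by case=> A k; rewrite andbT; apply: PE.
rewrite -(pair_big (fun A => Pe (val A)) xpredT (fun A _ => Fe (val A))) /=.
by apply: eq_bigr => A _; rewrite sumr_const card_ord mulr_natl.
Qed.

Lemma in_edges (A : {set G}) :
  A \in edges G -> exists x y, sedge x y /\ A = [set x; y].
Proof.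
rewrite inE => /existsP[x /existsP[y /andP[xy /eqP->]]].
by exists x, y.
Qed.

Lemma sum_foot (z : H) : \sum_x foot z x = 1.
Proof.
case: z => [y|[[A A_edge] k]] /=.
  by rewrite (bigD1 y) //= eqxx big1 ?addr0 // => x /negPf->.
have [x [y [xy ->]]] := in_edges _ A_edge.
transitivity (\sum_(z in [set x; y]) (1 / 2 : R)).
  by rewrite [RHS]big_mkcond; apply: eq_bigr => z _; case: ifP; rewrite ?mul0r.
by rewrite sum_edge //; field.
Qed.

(** The harmonic extension to the middle nodes. *)
Definition extend (w : G -> R) (z : H) : R := \sum_x foot z x * w x.

Lemma extend_inl w y : extend w (inl y) = w y.
Proof.
rewrite /extend (bigD1 y) //= eqxx mul1r big1 ?addr0 // => x /negPf->.
by rewrite mul0r.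
Qed.

Lemma extend_inr w A k : extend w (inr (A, k)) = (\sum_(x in val A) w x) / 2.
Proof.
rewrite /extend mulr_suml [RHS]big_mkcond; apply: eq_bigr => x _ /=.
by case: ifP => _; rewrite ?mul0r // mul1r mulrC.
Qed.

(** At an old node, each edge [xy] brings [w x - w y] and, through each of its
    [q] middle nodes, half of it. *)
Lemma laplacian_extend w z :
  laplacian (extend w) z = old_charge (fun x => (1 + q%:R / 2) * laplacian w x) z.
Proof.
case: z => [x|[[A A_edge] k]]; rewrite /laplacian.
  rewrite (@sum_triangulation _ _ (fun A => x \in A)
    (fun A => w x - (\sum_(y in A) w y) / 2)) // => [|A k]; last first.
    by rewrite extend_inl extend_inr.
  rewrite (sum_edges_at _ _ x (fun A => w x - (\sum_(y in A) w y) / 2)) /=.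
  rewrite mulrDl mul1r -mulrA; congr (_ + _ * _).
    by apply: eq_bigr => y _; rewrite !extend_inl.
  rewrite mulr_sumr; apply: eq_bigr => y xy.
  by rewrite sum_edge //; field.
rewrite (@sum_triangulation _ _ pred0
  (fun B => (\sum_(x in A) w x) / 2 - (\sum_(x in B) w x) / 2)) // => [|B l];
  last by rewrite !extend_inr.
rewrite [X in _ * X]big_pred0 ?mulr0 ?addr0 => [|B]; last exact: andbF.
rewrite /= extend_inr /=.
have [x [y [xy ->]]] := in_edges _ A_edge.
by rewrite !sum_edge // !extend_inl; field.
Qed.

Lemma deg_inr A k : (deg (inr (A, k) : H))%:R = 2 :> R.
Proof.
case: A => A A_edge; rewrite degE (@sum_triangulation _ _ pred0 (fun=> 1)) //.
rewrite [X in _ * X]big_pred0 ?mulr0 ?addr0 /= => [|B]; last exact: andbF.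
by have [x [y [xy ->]]] := in_edges _ A_edge; rewrite sum_edge.
Qed.

Lemma laplacian_lead (a z : H) :
  laplacian (fun y => (y == a)%:R * lead a) z =
  (z == a)%:R - old_charge (foot a) z.
Proof.
rewrite laplacian_delta; case: a => [y|[A k]] /=.
  rewrite mul0r; case: z => [x|p] /=; last by rewrite subr0.
  by rewrite (inj_eq (@inl_inj _ _)) subrr.
rewrite deg_inr; case: z => [x|[B l]] /=; first by rewrite sub0r mul0r; ring.
by rewrite subr0; field.
Qed.

(** The potential [2 / (q + 2) * extend w + lead a * 1_a - lead b * 1_b], where
    [w] solves the Poisson equation on [G] for the charge [foot a - foot b],
    carries a unit current from [a] to [b].  The factor [2 / (q + 2)] is the
    inverse of the one in [laplacian_extend]. *)
Lemma triangulation_resistance (g : G -> G -> R) (a b : H) :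
  (forall i x, laplacian (g i) x = (i == x)%:R - (#|G|%:R)^-1) ->
  resistance R a b = (a != b)%:R * (lead a + lead b)
    - (\sum_i \sum_j (foot a i - foot b i) * (foot a j - foot b j) *
        resistance R i j) / (q%:R + 2).
Proof.
move=> gE; pose c i := foot a i - foot b i.
have c0 : \sum_i c i = 0 by rewrite sumrB !sum_foot subrr.
have q2 : q%:R + 2 != 0 :> R by rewrite -natrD pnatr_eq0 addn2.
pose w x := \sum_i c i * g i x.
pose v z := 2 / (q%:R + 2) * extend w z + (z == a)%:R * lead a - (z == b)%:R * lead b.
rewrite (resistanceE _ _ _ _ v); last first.
  move=> z.
  transitivity (2 / (q%:R + 2) * laplacian (extend w) z +
    laplacian (fun y => (y == a)%:R * lead a) z -
    laplacian (fun y => (y == b)%:R * lead b) z).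
    rewrite /laplacian mulr_sumr -big_split -sumrB.
    by apply: eq_bigr => y _; rewrite /v /=; ring.
  rewrite laplacian_extend !laplacian_lead; case: z => [x|p] /=; last by ring.
  by rewrite laplacian_green_sum // /c; field.
have energy : extend w a - extend w b = \sum_x c x * w x.
  by rewrite -sumrB; apply: eq_bigr => x _; rewrite mulrBl.
have := @green_energy _ _ g gE c c0; rewrite -/w -energy => wab.
transitivity (2 / (q%:R + 2) * (extend w a - extend w b) +
  (a != b)%:R * (lead a + lead b)).
  rewrite /v !eqxx (eq_sym b a); case: eqP => [->|_] /=; by field.
by rewrite wab /c; field.
Qed.

Lemma sum_foot_vertices x : \sum_z foot z x = 1 + q%:R / 2 * (deg x)%:R.
Proof.
rewrite (@sum_triangulation _ _ xpredT (fun A => (x \in A)%:R / 2)) //.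
congr (_ + _).
  rewrite (bigD1 x) //= eqxx big1 ?addr0 // => y; rewrite eq_sym.
  by move=> /negPf->.
rewrite -mulrA; congr (_ * _); rewrite degE mulr_sumr.
rewrite -(sum_edges_at _ _ x (fun=> 2^-1 * 1)) [RHS]big_mkcondr.
apply: eq_big => A; first exact: andbT.
by move=> _; case: ifP => _; rewrite ?mul0r ?mul1r ?mulr1.
Qed.

Lemma sum_lead : \sum_z lead z = #|edges G|%:R * q%:R / 2.
Proof.
rewrite (@sum_triangulation _ _ xpredT (fun=> 1 / 2)) // big1 // add0r.
by rewrite big_condT sumr_const -mulr_natr; ring.
Qed.

Lemma sum_lead_pairs :
  \sum_a \sum_b (a != b)%:R * (lead a + lead b) =
  (#|H|%:R - 1) * (#|edges G|%:R * q%:R).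
Proof.
transitivity (\sum_a (\sum_b (lead a + lead b) - (lead a + lead a))).
  apply: eq_bigr => a _; rewrite [in RHS](bigD1 a) //= addrAC subrr add0r.
  rewrite [RHS]big_mkcond; apply: eq_bigr => b _; rewrite eq_sym.
  by case: ifP; rewrite ?mul1r ?mul0r.
under eq_bigr do rewrite big_split sumr_const.
by rewrite sumrB !big_split sumr_const /= sumrMnl -[_ *+ #|_|]mulr_natl !sum_lead; field.
Qed.

Lemma card_triangulation : #|H| = (#|G| + #|edges G| * q)%N.
Proof. by rewrite card_sum card_prod card_sig card_ord. Qed.

(** Only the two ordered pairs of distinct ends of an edge contribute, each with
    weight 1/4, for each of the [q] middle nodes of the edge. *)
Lemma sum_foot_self (f : G -> G -> R) : (forall x, f x x = 0) ->
  \sum_z \sum_x \sum_y foot z x * foot z y * f x y =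
  q%:R / 4 * \sum_x \sum_(y | sedge x y) f x y.
Proof.
move=> fxx.
rewrite (@sum_triangulation _ _ xpredT
  (fun A => (\sum_(x in A) \sum_(y in A) f x y) / 4)) // => [|A k]; last first.
  rewrite mulr_suml [RHS]big_mkcond; apply: eq_bigr => x _ /=.
  case: ifP => _; last by rewrite big1 // => y _; rewrite !mul0r.
  rewrite mulr_suml [RHS]big_mkcond; apply: eq_bigr => y _ /=.
  by case: ifP => _ /=; rewrite ?mulr0 ?mul0r //; field.
rewrite big1 ?add0r => [|z _]; last first.
  rewrite big1 // => x _; rewrite big1 // => y _ /=.
  by case: eqP => [->|]; case: eqP => [->|]; rewrite ?fxx ?(mul0r, mulr0).
rewrite -mulr_suml big_condT sum_edge_ends mulrA mulrAC; congr (_ * _).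
by apply: eq_bigr => x _; apply: eq_bigr => y _; rewrite fxx add0r.
Qed.

End Triangulation.

(** * Summation over pairs of nodes *)

Lemma double_sum_pairs (R : realFieldType) (G : sgraph) (f : G -> G -> R) :
  (forall x y, f x y = f y x) -> (forall x, f x x = 0) ->
  \sum_x \sum_y f x y = 2 * sum_pairs f.
Proof.
move=> fC fxx; rewrite mulr_natl mulr2n.
have gt_pairs : sum_pairs f =
    \sum_(x : G) \sum_(y : G | (enum_rank y < enum_rank x)%N) f x y.
  rewrite /sum_pairs (exchange_big_dep xpredT) //=.
  by apply: eq_bigr => x _; apply: eq_bigr => y _; rewrite fC.
rewrite [X in _ = _ + X]gt_pairs /sum_pairs -big_split; apply: eq_bigr => x _ /=.
rewrite (bigID (fun y => enum_rank x < enum_rank y)%N) /=; congr (_ + _).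
rewrite (bigD1 x) ?ltnn //= fxx add0r; apply: eq_bigl => y.
by rewrite -leqNgt ltn_neqAle andbC (inj_eq val_inj) (inj_eq enum_rank_inj).
Qed.

(** The mean squared distance of two independent random vectors of the same law
    is twice the second moment minus twice the square of the mean.  Here the
    vectors are the [p a], and squares are taken for the bilinear form [f]. *)
Lemma sum_sqr_diff (R : comRingType) (T I : finType) (p : T -> I -> R)
    (f : I -> I -> R) :
  \sum_a \sum_b \sum_i \sum_j (p a i - p b i) * (p a j - p b j) * f i j =
  2 * #|T|%:R * (\sum_a \sum_i \sum_j p a i * p a j * f i j) -
  2 * \sum_i \sum_j (\sum_a p a i) * (\sum_a p a j) * f i j.
Proof.
pose E a b := \sum_i \sum_j p a i * p b j * f i j.
have split a b : \sum_i \sum_j (p a i - p b i) * (p a j - p b j) * f i j =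
    E a a + E b b - E a b - E b a.
  rewrite -big_split -!sumrB; apply: eq_bigr => i _ /=.
  by rewrite -big_split -!sumrB; apply: eq_bigr => j _ /=; ring.
have cross : \sum_a \sum_b E a b =
    \sum_i \sum_j (\sum_a p a i) * (\sum_a p a j) * f i j.
  under eq_bigr do rewrite exchange_big; rewrite exchange_big.
  apply: eq_bigr => i _ /=.
  under eq_bigr do rewrite exchange_big; rewrite exchange_big.
  apply: eq_bigr => j _ /=; rewrite mulr_suml mulr_suml; apply: eq_bigr => a _.
  by rewrite mulr_sumr mulr_suml.
under eq_bigr do under eq_bigr do rewrite split.
under eq_bigr do rewrite !sumrB big_split sumr_const.
rewrite !sumrB big_split sumr_const /= -cross [X in _ - _ - X]exchange_big /=.
by rewrite sumrMnl -mulr_natr; ring.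
Qed.

Theorem theorem8 (R : realFieldType) (G : sgraph) (n m q : nat) :
  connected G -> #|G| = n -> #|edges G| = m -> (0 < q)%N ->
  kirchhoff R (triangulation q G) =
    2 / (q%:R + 2) * kirchhoff R G
    + q%:R / (q%:R + 2) * add_deg_kirchhoff R G
    + q%:R ^+ 2 / (2 * (q%:R + 2)) * mul_deg_kirchhoff R G
    + m%:R ^+ 2 * q%:R ^+ 2 / 2
    + (2 * m%:R - n%:R) * (n%:R - 1) * q%:R / (2 * (q%:R + 2)).
Proof.
move=> Gconn cardG cardE _.
have [g gE] := green_exists R _ Gconn.
have q2 : q%:R + 2 != 0 :> R by rewrite -natrD pnatr_eq0 addn2.
have pairs (H : sgraph) (f : H -> H -> R) : (forall x y, f x y = f y x) ->
    (forall x, f x x = 0) -> sum_pairs f = (\sum_x \sum_y f x y) / 2.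
  by move=> fC fxx; rewrite double_sum_pairs //; field.
rewrite /kirchhoff /add_deg_kirchhoff /mul_deg_kirchhoff !pairs; first last.
- by move=> x; rewrite resistancexx.
- by move=> x y; rewrite resistanceC.
- by move=> x; rewrite resistancexx.
- by move=> x y; rewrite resistanceC.
- by move=> x; rewrite resistancexx mulr0.
- by move=> x y; rewrite resistanceC addrC.
- by move=> x; rewrite resistancexx mulr0.
- by move=> x y; rewrite resistanceC (mulrC (deg x)%:R).
set N : R := #|triangulation q G|%:R.
have NE : N = n%:R + m%:R * q%:R.
  by rewrite /N card_triangulation natrD natrM cardG cardE.
under eq_bigr do under eq_bigr do rewrite (triangulation_resistance g _ _ gE).
under eq_bigr do rewrite sumrB -mulr_suml.
rewrite sumrB -mulr_suml sum_lead_pairs sum_sqr_diff -/N.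
rewrite (sum_foot_self _ (@resistancexx R G)) (foster g gE); last by case: Gconn.
under [X in _ - 2 * X]eq_bigr do under eq_bigr do rewrite !sum_foot_vertices.
have -> : \sum_(i : G) \sum_(j : G)
    (1 + q%:R / 2 * (deg i)%:R) * (1 + q%:R / 2 * (deg j)%:R) * resistance R i j =
  \sum_(i : G) \sum_j resistance R i j
  + q%:R / 2 * \sum_(i : G) \sum_j ((deg i)%:R + (deg j)%:R) * resistance R i j
  + (q%:R / 2) ^+ 2 * \sum_(i : G) \sum_j (deg i)%:R * (deg j)%:R * resistance R i j.
  rewrite !mulr_sumr -!big_split; apply: eq_bigr => i _ /=.
  rewrite !mulr_sumr -!big_split; apply: eq_bigr => j _ /=.
  by ring.
by rewrite NE cardG cardE; field.
Qed.
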